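(* Let $H=K\,\triangleright\!\!\!\blacktriangleleft L$ be a (right–left) bicrossproduct Hopf algebra. Suppose that $K$ and $L$ are equipped with $*$-structures satisfying the compatibility relation $$(l\triangleleft k)^*=l^*\triangleleft S(k)^*,\qquad k\in K,\ l\in L,$$ where $S(k)^*=(S(k))^*$. Then the expression $$(kl)^*=l^*k^*,\qquad k\in K,\ l\in L,$$ determines a $*$-structure on the algebra sector of $H$.
   Context: Sweedler notation $\Delta(c)=c_{(1)}\otimes c_{(2)}$ is used; $S$ is the antipode of $K$. A $*$-structure on a Hopf algebra is an antilinear involution that is an algebra antimorphism, $(ab)^*=b^*a^*$, and a coalgebra morphism, $\Delta(a^* )=(a_{(1)})^*\otimes(a_{(2)})^*$. A $*$-structure on the algebra sector of $H$ is an antilinear involution $*$ on $H$ with $(ab)^*=b^*a^*$. Right–left bicrossproduct: $K$ and $L$ are Hopf algebras over $\mathbb{R}$ or $\mathbb{C}$; $L$ is a right $K$-module algebra (action $l\triangleleft k$, with $(ll')\triangleleft k=(l\triangleleft k_{(1)})(l'\triangleleft k_{(2)})$ and $1\triangleleft k=\epsilon(k)1$) and $K$ is a left $L$-comodule coalgebra (coaction $k\mapsto k\blacktriangleleft\,=k^{(1)}\otimes k^{(2)}\in L\otimes K$) satisfying $\epsilon(l\triangleleft k)=\epsilon(l)\epsilon(k)$; $\Delta(l\triangleleft k)=(l_{(1)}\triangleleft k_{(1)}){k_{(2)}}^{(1)}\otimes l_{(2)}\triangleleft{k_{(2)}}^{(2)}$; $1\blacktriangleleft\,=1\otimes1$;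 $(kk')\blacktriangleleft\,=(k^{(1)}\triangleleft k'_{(1)}){k'_{(2)}}^{(1)}\otimes k^{(2)}{k'_{(2)}}^{(2)}$; ${k_{(1)}}^{(1)}(l\triangleleft k_{(2)})\otimes{k_{(1)}}^{(2)}=(l\triangleleft k_{(1)}){k_{(2)}}^{(1)}\otimes{k_{(2)}}^{(2)}$. $H=K\triangleright\!\!\!\blacktriangleleft L$ is the vector space $K\otimes L$ with product $(k\otimes l)(k'\otimes l')=kk'_{(1)}\otimes(l\triangleleft k'_{(2)})l'$ and coproduct $\Delta(k\otimes l)=k_{(1)}\otimes{k_{(2)}}^{(1)}l_{(1)}\otimes{k_{(2)}}^{(2)}\otimes l_{(2)}$. One identifies $k$ with $k\otimes1$ and $l$ with $1\otimes l$, so $kl=k\otimes l$ and $lk=k_{(1)}(l\triangleleft k_{(2)})$. *)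

(* Defs.v *)
From HB Require Import structures.
From mathcomp Require Import all_boot all_order all_algebra.
From mathcomp Require Import complex boolp reals.

Set Implicit Arguments.
Unset Strict Implicit.
Unset Printing Implicit Defensive.

Import GRing.Theory.

Local Open Scope ring_scope.
Local Open Scope quotient_scope.

(* V ⊗ W is the quotient of the formal sums of pairs (lists over V * W) by the
   relation identifying two formal sums that have the same value under every
   balanced biadditive map, i.e. the universal property is built in. Allowing
   all abelian groups as targets makes antilinear maps factor as well.        *)
Section Tensor.
Variables (F : fieldType) (V W : lmodType F).
Implicit Types (Z : zmodType) (s : seq (V * W)).

Record balanced Z (f : V -> W -> Z) : Prop := Balanced {
  balancedDl : forall x x' y, f (x + x') y = f x y + f x' y;
  balancedDr : forall x y y', f x (y + y') = f x y + f x y';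
  balancedZ : forall (a : F) x y, f (a *: x) y = f x (a *: y)
}.

Definition formal_eval Z (f : V -> W -> Z) s : Z :=
  \sum_(p <- s) f p.1 p.2.

Definition formal_eq s t : bool :=
  `[< forall Z (f : V -> W -> Z), balanced f -> formal_eval f s = formal_eval f t >].

Lemma formal_eq_refl : reflexive formal_eq.
Proof. by move=> s; apply/asboolP. Qed.

Lemma formal_eq_sym : symmetric formal_eq.
Proof. by move=> s t; apply/asboolP/asboolP => h Z f /h ->. Qed.

Lemma formal_eq_trans : transitive formal_eq.
Proof.
move=> t s u /asboolP h1 /asboolP h2; apply/asboolP => Z f bf.
by rewrite h1 // h2.
Qed.

Canonical formal_equiv :=
  EquivRel formal_eq formal_eq_refl formal_eq_sym formal_eq_trans.

Definition tensor : Type := {eq_quot formal_equiv}.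
HB.instance Definition _ := Choice.on tensor.
HB.instance Definition _ := EqQuotient.on tensor.

(* The Sweedler sum of f over a tensor t = \sum_i x_i ⊗ y_i, namely
   \sum_i f x_i y_i; tsum_pi says that for balanced f the value does not
   depend on the chosen expression of t.                                     *)
Definition tsum Z (f : V -> W -> Z) (t : tensor) : Z :=
  formal_eval f (repr t).

Definition pure (x : V) (y : W) : tensor := \pi_tensor [:: (x, y)].

Lemma tsum_pi Z (f : V -> W -> Z) s :
  balanced f -> tsum f (\pi_tensor s) = formal_eval f s.
Proof.
move=> bf; have /asboolP /(_ Z f bf) : formal_eq (repr (\pi_tensor s)) s.
  by apply/(@eqmodP _ formal_equiv); exact: reprK.
by [].
Qed.

Lemma tsum_pure Z (f : V -> W -> Z) x y :
  balanced f -> tsum f (pure x y) = f x y.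
Proof. by move=> bf; rewrite tsum_pi // /formal_eval big_seq1. Qed.

Lemma tensor_ext (t u : tensor) :
  (forall Z (f : V -> W -> Z), balanced f -> tsum f t = tsum f u) -> t = u.
Proof.
move=> h; rewrite -[t]reprK -[u]reprK; apply/eqmodP/asboolP => Z f bf.
exact: h.
Qed.

Definition tadd (t u : tensor) : tensor := \pi_tensor (repr t ++ repr u).
Definition tscale (a : F) (t : tensor) : tensor :=
  \pi_tensor [seq (a *: p.1, p.2) | p <- repr t].
Definition tzero : tensor := \pi_tensor [::].
Definition topp : tensor -> tensor := tscale (-1).

Lemma balanced_scale Z (f : V -> W -> Z) (a : F) :
  balanced f -> balanced (fun x y => f (a *: x) y).
Proof.
case=> fl fr fz; split=> [x x' y|x y y'|b x y]; first by rewrite scalerDr.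
  by rewrite fr.
by rewrite scalerA mulrC -scalerA fz.
Qed.

Lemma tsum_tadd Z (f : V -> W -> Z) t u :
  balanced f -> tsum f (tadd t u) = tsum f t + tsum f u.
Proof. by move=> bf; rewrite tsum_pi // /formal_eval big_cat. Qed.

Lemma tsum_tscale Z (f : V -> W -> Z) a t :
  balanced f -> tsum f (tscale a t) = tsum (fun x y => f (a *: x) y) t.
Proof. by move=> bf; rewrite tsum_pi // /formal_eval big_map. Qed.

Lemma tsum_tzero Z (f : V -> W -> Z) : balanced f -> tsum f tzero = 0.
Proof. by move=> bf; rewrite tsum_pi // /formal_eval big_nil. Qed.

Fact taddA : associative tadd.
Proof. by move=> t u v; apply: tensor_ext => Z f bf; rewrite !tsum_tadd // addrA. Qed.

Fact taddC : commutative tadd.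
Proof. by move=> t u; apply: tensor_ext => Z f bf; rewrite !tsum_tadd // addrC. Qed.

Fact tadd0 : left_id tzero tadd.
Proof.
by move=> t; apply: tensor_ext => Z f bf; rewrite tsum_tadd // tsum_tzero // add0r.
Qed.

Fact taddN : left_inverse tzero topp tadd.
Proof.
move=> t; apply: tensor_ext => Z f bf.
rewrite tsum_tadd // tsum_tscale // tsum_tzero // -big_split big1 // => p _ /=.
rewrite -(balancedDl bf) scaleN1r addNr.
by apply: (addrI (f 0 p.2)); rewrite -(balancedDl bf) !addr0.
Qed.

HB.instance Definition _ := GRing.isZmodule.Build tensor taddA taddC tadd0 taddN.

Lemma tsumD Z (f : V -> W -> Z) t u :
  balanced f -> tsum f (t + u) = tsum f t + tsum f u.
Proof. exact: tsum_tadd. Qed.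

Fact tscaleA a b t : tscale a (tscale b t) = tscale (a * b) t.
Proof.
apply: tensor_ext => Z f bf; rewrite !tsum_tscale //; last exact: balanced_scale.
by apply: eq_bigr => p _; rewrite scalerA mulrC.
Qed.

Fact tscale1 : left_id 1 tscale.
Proof.
move=> t; apply: tensor_ext => Z f bf; rewrite tsum_tscale //.
by apply: eq_bigr => p _; rewrite scale1r.
Qed.

Fact tscaleDr : right_distributive tscale +%R.
Proof.
move=> a t u; apply: tensor_ext => Z f bf; have bfa := balanced_scale a bf.
by rewrite tsum_tscale // !tsumD // !tsum_tscale.
Qed.

Fact tscaleDl t : {morph tscale^~ t : a b / a + b}.
Proof.
move=> a b; apply: tensor_ext => Z f bf.
rewrite tsumD // !tsum_tscale // -big_split /=.
by apply: eq_bigr => p _; rewrite scalerDl (balancedDl bf).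
Qed.

HB.instance Definition _ :=
  GRing.Zmodule_isLmodule.Build F tensor tscaleA tscale1 tscaleDr tscaleDl.

Lemma tsumZ Z (f : V -> W -> Z) a t :
  balanced f -> tsum f (a *: t) = tsum (fun x y => f (a *: x) y) t.
Proof. exact: tsum_tscale. Qed.

Lemma pure_balanced : balanced pure.
Proof.
split=> [x x' y|x y y'|a x y]; apply: tensor_ext => Z f bf;
  rewrite ?tsumD // !tsum_pure //; case: bf; auto.
Qed.

Lemma pureZl a x y : pure (a *: x) y = a *: pure x y.
Proof.
apply: tensor_ext => Z f bf; rewrite tsumZ // !tsum_pure //.
exact: balanced_scale.
Qed.

Lemma pureZr a x y : pure x (a *: y) = a *: pure x y.
Proof. by rewrite -(balancedZ pure_balanced) pureZl. Qed.

Lemma pureDl x x' y : pure (x + x') y = pure x y + pure x' y.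
Proof. exact: balancedDl pure_balanced _ _ _. Qed.

Lemma pureDr x y y' : pure x (y + y') = pure x y + pure x y'.
Proof. exact: balancedDr pure_balanced _ _ _. Qed.

Lemma tsum_id t : tsum pure t = t.
Proof.
rewrite -{2}[t]reprK /tsum; elim: (repr t) => [|[x y] s ih].
  by rewrite /formal_eval big_nil.
rewrite /formal_eval big_cons -/(formal_eval pure s) ih /=.
apply: tensor_ext => Z f bf; rewrite tsumD // tsum_pure // !tsum_pi //.
by rewrite /formal_eval big_cons.
Qed.

Lemma tensor_ind (P : tensor -> Prop) :
  P 0 -> (forall t u, P t -> P u -> P (t + u)) -> (forall x y, P (pure x y)) ->
  forall t, P t.
Proof.
move=> P0 PD Pp t; rewrite -(tsum_id t) /tsum /formal_eval.
by elim/big_ind: _ => // p _.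
Qed.

Lemma eq_tsum Z (f g : V -> W -> Z) t :
  (forall x y, f x y = g x y) -> tsum f t = tsum g t.
Proof. by move=> fg; apply: eq_bigr => p _. Qed.

Lemma tsum_split Z (f g : V -> W -> Z) t :
  tsum (fun x y => f x y + g x y) t = tsum f t + tsum g t.
Proof. exact: big_split. Qed.

Lemma raddf_tsum Z Z' (g : Z -> Z') (f : V -> W -> Z) t :
  {morph g : x y / x + y} -> g (tsum f t) = tsum (fun x y => g (f x y)) t.
Proof.
move=> gD; apply: (big_morph g gD).
by apply: (addrI (g 0)); rewrite -gD !addr0.
Qed.

End Tensor.

Arguments tensor {F} V W.
Arguments pure {F V W} x y.

Reserved Notation "x ⊗ y" (at level 45, left associativity).
Reserved Notation "\sw_ ( x , y <- t ) E"
  (at level 46, x name, y name, t at level 200, right associativity,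
   format "\sw_ ( x ,  y  <-  t )  E").

Notation "V ⊗ W" := (tensor V W) : type_scope.
Notation "x ⊗ y" := (pure x y) : ring_scope.
Notation "\sw_ ( x , y <- t ) E" := (tsum (fun x y => E) t) : ring_scope.

Lemma tsum_tsum (F : fieldType) (V W V' W' : lmodType F) (Z : zmodType)
    (f : V -> W -> Z) (g : V' -> W' -> V ⊗ W) (t : V' ⊗ W') :
  balanced f -> tsum f (tsum g t) = \sw_(x, y <- t) tsum f (g x y).
Proof. by move=> bf; apply: raddf_tsum => u v; rewrite tsumD. Qed.

HB.mixin Record isHopf (F : fieldType) A of GRing.Algebra F A := {
  comul : A -> A ⊗ A;
  counit : A -> F;
  antipode : A -> A;
  comul_linear : linear comul;
  counit_linear : scalar counit;
  antipode_linear : linear antipode;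
  comulA : forall c,
    \sw_(x, y <- comul c) \sw_(x1, x2 <- comul x) (x1 ⊗ (x2 ⊗ y))
      = \sw_(x, y <- comul c) (x ⊗ comul y);
  comul_counitl : forall c, \sw_(x, y <- comul c) counit x *: y = c;
  comul_counitr : forall c, \sw_(x, y <- comul c) counit y *: x = c;
  comul1 : comul 1 = 1 ⊗ 1;
  comulM : forall a b, comul (a * b) =
    \sw_(a1, a2 <- comul a) \sw_(b1, b2 <- comul b) (a1 * b1 ⊗ a2 * b2);
  counit1 : counit 1 = 1;
  counitM : forall a b, counit (a * b) = counit a * counit b;
  antipodel : forall c, \sw_(x, y <- comul c) antipode x * y = (counit c)%:A;
  antipoder : forall c, \sw_(x, y <- comul c) x * antipode y = (counit c)%:A
}.

#[short(type="hopfAlgType")]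
HB.structure Definition HopfAlgebra (F : fieldType) :=
  {A of GRing.Algebra F A & isHopf F A}.

Section Linear.
Variables (F : fieldType) (U Z : lmodType F).

Lemma lin0 (f : U -> Z) : linear f -> f 0 = 0.
Proof.
move=> hf; have := hf (-1) 0 0.
by rewrite scaler0 addr0 scaleN1r addNr.
Qed.

Lemma linZ (f : U -> Z) a u : linear f -> f (a *: u) = a *: f u.
Proof. by move=> hf; rewrite -[a *: u]addr0 hf (lin0 hf) addr0. Qed.

Lemma lin_id : linear (fun x : U => x).
Proof. by []. Qed.

End Linear.

Section Linearity.
Variables (F : fieldType) (U V W V' W' Z : lmodType F).

Lemma balanced_lin (f : V -> W -> Z) :
  (forall y, linear (fun x => f x y)) -> (forall x, linear (fun y => f x y)) ->
  balanced f.
Proof.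
move=> fl fr; split=> [x x' y|x y y'|a x y].
- by have := fl y 1 x x'; rewrite !scale1r.
- by have := fr x 1 y y'; rewrite !scale1r.
by rewrite (linZ a x (fl y)) (linZ a y (fr x)).
Qed.

Lemma lin_purel (f : U -> V) (y : W) : linear f -> linear (fun x => f x ⊗ y).
Proof. by move=> hf a u v; rewrite hf pureDl pureZl. Qed.

Lemma lin_purer (f : U -> W) (y : V) : linear f -> linear (fun x => y ⊗ f x).
Proof. by move=> hf a u v; rewrite hf pureDr pureZr. Qed.

Lemma lin_tsumf (f : U -> V -> W -> Z) t :
  (forall x y, linear (fun u => f u x y)) -> linear (fun u => tsum (f u) t).
Proof.
move=> hf a u v; rewrite (@raddf_tsum _ _ _ _ _ ( *:%R a)); last exact: scalerDr.
by rewrite -tsum_split; apply: eq_tsum => x y; rewrite hf.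
Qed.

Lemma lin_tsumt (f : V -> W -> Z) (g : U -> V ⊗ W) :
  (forall y, linear (fun x => f x y)) -> (forall x, linear (fun y => f x y)) ->
  linear g -> linear (fun u => tsum f (g u)).
Proof.
move=> fl fr hg a u v; have bf := balanced_lin fl fr.
rewrite hg tsumD // tsumZ //; congr (_ + _).
rewrite (@raddf_tsum _ _ _ _ _ ( *:%R a)); last exact: scalerDr.
by apply: eq_tsum => x y; rewrite (linZ a x (fl y)).
Qed.

Lemma exchange_tsum (f : V -> W -> V' -> W' -> Z) t t' :
  \sw_(x, y <- t) \sw_(x', y' <- t') f x y x' y' =
  \sw_(x', y' <- t') \sw_(x, y <- t) f x y x' y'.
Proof. exact: exchange_big. Qed.

End Linearity.

Lemma lin_mull (F : fieldType) (U : lmodType F) (A : algType F) (f : U -> A) c :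
  linear f -> linear (fun x => f x * c).
Proof. by move=> hf a u v; rewrite hf mulrDl scalerAl. Qed.

Lemma lin_mulr (F : fieldType) (U : lmodType F) (A : algType F) (f : U -> A) c :
  linear f -> linear (fun x => c * f x).
Proof. by move=> hf a u v; rewrite hf mulrDr scalerAr. Qed.

Lemma lin_comul (F : fieldType) (U : lmodType F) (A : hopfAlgType F)
  (f : U -> A) : linear f -> linear (fun x => comul (f x)).
Proof. by move=> hf a u v; rewrite hf comul_linear. Qed.

Lemma coassoc_tsum (F : fieldType) (A : hopfAlgType F) (Z : lmodType F)
    (T : A -> A -> A -> Z) (c : A) :
  (forall y z, linear (fun x => T x y z)) ->
  (forall x z, linear (fun y => T x y z)) ->
  (forall x y, linear (fun z => T x y z)) ->
  \sw_(x, y <- comul c) \sw_(x1, x2 <- comul x) T x1 x2 y =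
  \sw_(x, y <- comul c) \sw_(y1, y2 <- comul y) T x y1 y2.
Proof.
move=> T1 T2 T3.
have b2 x : balanced (fun y z => T x y z) by apply: balanced_lin.
have b1 : balanced (fun x (t : A ⊗ A) => tsum (T x) t).
  apply: balanced_lin => [t|x]; first exact: lin_tsumf.
  by apply: lin_tsumt => //; exact: lin_id.
have := congr1 (tsum (fun x (t : A ⊗ A) => tsum (T x) t)) (comulA c).
rewrite !tsum_tsum // => h.
transitivity (\sw_(x, y <- comul c)
    tsum (fun x0 t => tsum (T x0) t) (x ⊗ comul y)); last first.
  by apply: eq_tsum => x y; rewrite tsum_pure.
rewrite -h; apply: eq_tsum => x y; rewrite tsum_tsum //.
by apply: eq_tsum => x1 x2; rewrite !tsum_pure.
Qed.

Section Bicrossproduct.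
Variables (F : fieldType) (K L : hopfAlgType F).

Record right_module_algebra (act : L -> K -> L) : Prop := {
  act_linearl : forall k, linear (act^~ k);
  act_linearr : forall l, linear (act l);
  act_1 : forall l, act l 1 = l;
  act_M : forall l k k', act l (k * k') = act (act l k) k';
  act_algM : forall l l' k, act (l * l') k =
    \sw_(k1, k2 <- comul k) act l k1 * act l' k2;
  act_alg1 : forall k, act 1 k = (counit k)%:A
}.

Record left_comodule_coalgebra (coact : K -> L ⊗ K) : Prop := {
  coact_linear : linear coact;
  coact_coassoc : forall k,
    \sw_(l, m <- coact k) \sw_(l1, l2 <- comul l) (l1 ⊗ (l2 ⊗ m))
      = \sw_(l, m <- coact k) (l ⊗ coact m);
  coact_counit : forall k, \sw_(l, m <- coact k) counit l *: m = k;
  coact_comul : forall k,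
    \sw_(l, m <- coact k) (l ⊗ comul m)
      = \sw_(k1, k2 <- comul k) \sw_(l1, m1 <- coact k1) \sw_(l2, m2 <- coact k2)
          (l1 * l2 ⊗ (m1 ⊗ m2));
  coact_counit_coalg : forall k,
    \sw_(l, m <- coact k) counit m *: l = (counit k)%:A
}.

Record bicross_compatible (act : L -> K -> L) (coact : K -> L ⊗ K) : Prop := {
  bicross_counit : forall l k, counit (act l k) = counit l * counit k;
  bicross_comul : forall l k, comul (act l k) =
    \sw_(l1, l2 <- comul l) \sw_(k1, k2 <- comul k) \sw_(p, q <- coact k2)
      (act l1 k1 * p ⊗ act l2 q);
  bicross_coact1 : coact 1 = 1 ⊗ 1;
  bicross_coactM : forall k k', coact (k * k') =
    \sw_(p, q <- coact k) \sw_(k1, k2 <- comul k') \sw_(p', q' <- coact k2)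
      (act p k1 * p' ⊗ q * q');
  bicross_comm : forall l k,
    \sw_(k1, k2 <- comul k) \sw_(p, q <- coact k1) (p * act l k2 ⊗ q)
      = \sw_(k1, k2 <- comul k) \sw_(p, q <- coact k2) (act l k1 * p ⊗ q)
}.

Record bicross_data := BicrossData {
  act : L -> K -> L;
  coact : K -> L ⊗ K;
  act_module_algebra : right_module_algebra act;
  coact_comodule_coalgebra : left_comodule_coalgebra coact;
  act_coact_compatible : bicross_compatible act coact
}.

(* The vector space K ⊗ L of the right-left bicrossproduct; the argument B is
   a phantom carrying the product.                                           *)
Definition bicrossproduct (B : bicross_data) : Type := K ⊗ L.

Variable B : bicross_data.
HB.instance Definition _ := GRing.Lmodule.on (bicrossproduct B).

Definition bicross_mul (u v : bicrossproduct B) : bicrossproduct B :=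
  \sw_(k, l <- u) \sw_(k', l' <- v) \sw_(k1, k2 <- comul k')
    (k * k1 ⊗ act B l k2 * l').

Definition bicross_one : bicrossproduct B := 1 ⊗ 1.

Lemma lin_actl (V : lmodType F) (f : V -> L) k :
  linear f -> linear (fun x => act B (f x) k).
Proof. by move=> hf a x y; rewrite hf (act_linearl (act_module_algebra B)). Qed.

Lemma lin_actr (V : lmodType F) (f : V -> K) l :
  linear f -> linear (fun x => act B l (f x)).
Proof. by move=> hf a x y; rewrite hf (act_linearr (act_module_algebra B)). Qed.

Ltac lin := repeat (intros; (first
  [ apply: lin_id | apply: balanced_lin | apply: lin_mull | apply: lin_mulr
  | apply: lin_purel | apply: lin_purer | apply: lin_actl | apply: lin_actr
  | apply: lin_comul | apply: lin_tsumf | apply: lin_tsumt ])).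

Lemma bicross_mulE k l k' l' : bicross_mul (k ⊗ l) (k' ⊗ l') =
  \sw_(k1, k2 <- comul k') (k * k1 ⊗ act B l k2 * l').
Proof. by rewrite /bicross_mul !tsum_pure //; lin. Qed.

Lemma bicross_mul_linl v : linear (bicross_mul^~ v).
Proof. by lin. Qed.

Lemma bicross_mul_linr u : linear (bicross_mul u).
Proof. by lin. Qed.

Lemma bicross_mulDl : left_distributive bicross_mul +%R.
Proof. by move=> x y z; have := bicross_mul_linl z 1 x y; rewrite !scale1r. Qed.

Lemma bicross_mulDr : right_distributive bicross_mul +%R.
Proof. by move=> x y z; have := bicross_mul_linr x 1 y z; rewrite !scale1r. Qed.

Lemma bicross_mul_tsuml (V W : lmodType F) (f : V -> W -> K ⊗ L) (t : V ⊗ W) v :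
  bicross_mul (tsum f t) v = \sw_(x, y <- t) bicross_mul (f x y) v.
Proof.
by rewrite (raddf_tsum (g := bicross_mul^~ v)) // => x y; exact: bicross_mulDl.
Qed.

Lemma bicross_mul_tsumr (V W : lmodType F) (f : V -> W -> K ⊗ L) (t : V ⊗ W) u :
  bicross_mul u (tsum f t) = \sw_(x, y <- t) bicross_mul u (f x y).
Proof. by rewrite (raddf_tsum (g := bicross_mul u)) //; exact: bicross_mulDr. Qed.

Lemma bicross_mulA : associative bicross_mul.
Proof.
move=> u v w; elim/tensor_ind: u => [|u1 u2 h1 h2|k l].
- by rewrite !(lin0 (bicross_mul_linl _)).
- by rewrite !bicross_mulDl h1 h2.
elim/tensor_ind: v => [|v1 v2 h1 h2|k' l'].
- by rewrite (lin0 (bicross_mul_linl _)) !(lin0 (bicross_mul_linr _)) (lin0 (bicross_mul_linl _)).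
- by rewrite bicross_mulDl !bicross_mulDr bicross_mulDl h1 h2.
elim/tensor_ind: w => [|w1 w2 h1 h2|k'' l''].
- by rewrite !(lin0 (bicross_mul_linr _)).
- by rewrite !bicross_mulDr h1 h2.
rewrite !bicross_mulE.
rewrite bicross_mul_tsuml bicross_mul_tsumr.
transitivity (\sw_(k1, k2 <- comul k') \sw_(a, b <- comul k'')
  \sw_(a1, a2 <- comul a)
    (k * k1 * a1 ⊗ act B (act B l k2) a2 * act B l' b * l'')); last first.
  apply: eq_tsum => k1 k2; rewrite bicross_mulE.
  rewrite (coassoc_tsum (T := fun a b c =>
    k * k1 * a ⊗ act B (act B l k2) b * act B l' c * l'')); try by lin.
  apply: eq_tsum => a b; rewrite (act_algM (act_module_algebra B)).
  rewrite -(raddf_tsum _ _ (fun x y => pureDr (k * k1 * a) x y)).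
  by rewrite -(raddf_tsum _ _ (fun x y => mulrDl x y l'')).
rewrite [RHS]exchange_tsum; apply: eq_tsum => a b.
rewrite bicross_mulE comulM tsum_tsum; last by lin.
apply: eq_tsum => k1 k2; rewrite tsum_tsum; last by lin.
apply: eq_tsum => a1 a2; rewrite tsum_pure; last by lin.
by rewrite (act_M (act_module_algebra B)) !mulrA.
Qed.

Lemma bicross_mul1 : left_id bicross_one bicross_mul.
Proof.
elim/tensor_ind => [|u1 u2 h1 h2|k l].
- by rewrite (lin0 (bicross_mul_linr _)).
- by rewrite bicross_mulDr h1 h2.
rewrite bicross_mulE -[in RHS](comul_counitr k).
rewrite (raddf_tsum _ _ (fun x y => pureDl x y l)).
apply: eq_tsum => k1 k2; rewrite mul1r (act_alg1 (act_module_algebra B)).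
by rewrite mulr_algl pureZr pureZl.
Qed.

Lemma bicross_mulr1 : right_id bicross_one bicross_mul.
Proof.
elim/tensor_ind => [|u1 u2 h1 h2|k l].
- by rewrite (lin0 (bicross_mul_linl _)).
- by rewrite bicross_mulDl h1 h2.
rewrite bicross_mulE comul1 tsum_pure; last by lin.
by rewrite (act_1 (act_module_algebra B)) !mulr1.
Qed.

Lemma bicross_one_neq0 : bicross_one != 0.
Proof.
have bal : balanced (fun (k : K) (l : L) => counit k * counit l).
  split=> [x x' y|x y y'|a x y].
  - by have := counit_linear 1 x x'; rewrite scale1r mul1r => ->; rewrite mulrDl.
  - by have := counit_linear 1 y y'; rewrite scale1r mul1r => ->; rewrite mulrDr.
  have h (A : hopfAlgType F) (z : A) : counit (a *: z) = a * counit z.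
    have c0 : counit (0 : A) = 0.
      have := counit_linear 1 (0 : A) 0; rewrite scale1r mul1r addr0 => /eqP.
      by rewrite eq_sym -subr_eq0 addrK => /eqP.
    by have := counit_linear a z 0; rewrite c0 !addr0.
  by rewrite !h mulrCA mulrA.
apply/eqP => e; have := tsum_pure 1 1 bal; rewrite !counit1 mulr1.
have /(canRL (addrK _)) : tsum (fun k l => counit k * counit l) bicross_one
    + tsum (fun k l => counit k * counit l) bicross_one
    = tsum (fun k l => counit k * counit l) bicross_one.
  by rewrite -tsumD // e addr0.
rewrite subrr -[1 ⊗ 1]/bicross_one => -> /eqP.
by rewrite eq_sym oner_eq0.
Qed.

HB.instance Definition _ := GRing.Zmodule_isNzRing.Build (bicrossproduct B)
  bicross_mulA bicross_mul1 bicross_mulr1 bicross_mulDl bicross_mulDr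
  bicross_one_neq0.

Fact bicross_scalerAl a (u v : bicrossproduct B) : a *: (u * v) = (a *: u) * v.
Proof. by rewrite -[RHS]/(bicross_mul _ _) (linZ a u (bicross_mul_linl v)). Qed.

HB.instance Definition _ :=
  GRing.Lmodule_isLalgebra.Build F (bicrossproduct B) bicross_scalerAl.

Fact bicross_scalerAr a (u v : bicrossproduct B) : a *: (u * v) = u * (a *: v).
Proof. by rewrite -[RHS]/(bicross_mul _ _) (linZ a v (bicross_mul_linr u)). Qed.

HB.instance Definition _ :=
  GRing.Lalgebra_isAlgebra.Build F (bicrossproduct B) bicross_scalerAr.

Definition inK (k : K) : bicrossproduct B := k ⊗ 1.
Definition inL (l : L) : bicrossproduct B := 1 ⊗ l.

Lemma inK_inL k l : inK k * inL l = k ⊗ l.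
Proof.
rewrite -[LHS]/(bicross_mul _ _) bicross_mulE comul1 tsum_pure; last by lin.
by rewrite (act_1 (act_module_algebra B)) mulr1 mul1r.
Qed.

Lemma inL_inK l k :
  inL l * inK k = \sw_(k1, k2 <- comul k) (k1 ⊗ act B l k2).
Proof.
rewrite -[LHS]/(bicross_mul _ _) bicross_mulE.
by apply: eq_tsum => k1 k2; rewrite mul1r mulr1.
Qed.

End Bicrossproduct.

Section StarStructures.
Variables (F : fieldType) (conjF : F -> F).

Definition antilinear (V W : lmodType F) (f : V -> W) : Prop :=
  forall a u v, f (a *: u + v) = conjF a *: f u + f v.

Record star_structure (A : algType F) (star : A -> A) : Prop := {
  star_antilinear : antilinear star;
  star_involutive : involutive star;
  starM : forall a b, star (a * b) = star b * star a
}.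

Record hopf_star_structure (A : hopfAlgType F) (star : A -> A) : Prop := {
  hopf_star : star_structure star;
  star_comul : forall a,
    comul (star a) = \sw_(a1, a2 <- comul a) (star a1 ⊗ star a2)
}.

End StarStructures.

(* The ground field with its conjugation, for a given model R of the reals. *)
Variant real_or_complex (R : realType) : forall F : fieldType, (F -> F) -> Prop :=
| GroundReal : @real_or_complex R R (fun x => x)
| GroundComplex : @real_or_complex R R[i] (@conjc R).

(* Main.v *)
(* The only point needing the compatibility relation is (l k)^* = k^* l^*. Since
   l k = k_1 (l ◁ k_2), the left side is (l^* ◁ S(k_2)^* ) k_1^*; moving k_1^* to
   the left turns it into k_1^* (l^* ◁ (k_2 S(k_3))^* ), which is k^* l^*. General
   antimultiplicativity follows by writing (k l)(k' l') = k (l k') l', and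
   involutivity by applying antimultiplicativity to l^* k^*.                  *)
Require Import Defs.
From HB Require Import structures.
From mathcomp Require Import all_boot all_order all_algebra.
From mathcomp Require Import complex boolp reals.

Local Open Scope ring_scope.

Set Implicit Arguments.
Unset Strict Implicit.

Import GRing.Theory.

(** * Antilinear maps and tensor sums *)

Section Antilinear.
Variables (F : fieldType) (conjF : F -> F).
Hypothesis conj1 : conjF 1 = 1.

Lemma antilinearD {V W : lmodType F} {f : V -> W} :
  antilinear conjF f -> {morph f : x y / x + y}.
Proof. by move=> hf x y; have := hf 1 x y; rewrite conj1 !scale1r. Qed.

Lemma antilinear0 {V W : lmodType F} {f : V -> W} :
  antilinear conjF f -> f 0 = 0.
Proof. by move=> hf; apply: (addrI (f 0)); rewrite -(antilinearD hf) !addr0. Qed.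

Lemma antilinearZ {V W : lmodType F} {f : V -> W} a x :
  antilinear conjF f -> f (a *: x) = conjF a *: f x.
Proof. by move=> hf; have := hf a x 0; rewrite (antilinear0 hf) !addr0. Qed.

Lemma antilinear_comp {U V W : lmodType F} {g : V -> W} {f : U -> V} :
  linear g -> antilinear conjF f -> antilinear conjF (fun x => g (f x)).
Proof. by move=> hg hf a x y; rewrite hf hg. Qed.

Section Biantilinear.
Variables (V W Z : lmodType F) (f : V -> W -> Z).
Hypothesis fl : forall y, antilinear conjF (fun x => f x y).
Hypothesis fr : forall x, antilinear conjF (f x).

(** A scalar leaves either argument as the same factor [conjF a], so it can be moved across the
    tensor sign. Hence biantilinear maps also factor through [V ⊗ W]. *)
Lemma balanced_antilinear : balanced f.
Proof.
split=> [x x' y|x y y'|a x y].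
- exact: (antilinearD (fl y)).
- exact: (antilinearD (fr x)).
- by rewrite (antilinearZ a x (fl y)) (antilinearZ a y (fr x)).
Qed.

Lemma antilinear_tsum : antilinear conjF (tsum f).
Proof.
move=> a u v; have bf := balanced_antilinear.
rewrite tsumD // tsumZ //; congr (_ + _).
rewrite (@raddf_tsum _ _ _ _ _ ( *:%R (conjF a))); last exact: scalerDr.
by apply: eq_tsum => x y; rewrite (antilinearZ a x (fl y)).
Qed.

End Biantilinear.

(** Evaluate the star of [1 * star 1] with and without antimultiplicativity. *)
Lemma star1 (A : algType F) (star : A -> A) :
  star_structure conjF star -> star 1 = 1.
Proof.
by case=> _ sI sM; have := sM 1 (star 1); rewrite mul1r sI mul1r.
Qed.

End Antilinear.

(** Coassociativity regroups the three factors so that the antipode axiom applies to the last two;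
    the counit axiom then absorbs what remains. *)
Lemma comul_antipoder (F : fieldType) (K : hopfAlgType F) (k : K) :
  \sw_(x, y <- comul k) \sw_(x1, x2 <- comul x) (x1 ⊗ (x2 * antipode y)) = k ⊗ 1.
Proof.
rewrite (coassoc_tsum (T := fun x y z => x ⊗ (y * antipode z))); last first.
- move=> x y; apply: lin_purer; apply: lin_mulr; exact: antipode_linear.
- move=> x z; apply: lin_purer; apply: lin_mull; exact: lin_id.
- move=> y z; apply: lin_purel; exact: lin_id.
rewrite -[in RHS](comul_counitr k) (raddf_tsum _ _ (fun x y => pureDl x y 1)).
apply: eq_tsum => x y.
by rewrite -(raddf_tsum _ _ (pureDr x)) antipoder pureZr pureZl.
Qed.

(** * [K] and [L] as subalgebras of the bicrossproduct *)

Section Embeddings.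
Variables (F : fieldType) (K L : hopfAlgType F) (B : bicross_data K L).

Lemma inL_linear : linear (inL B).
Proof. exact: lin_purer (@lin_id _ _). Qed.

Lemma inK_linear : linear (inK B).
Proof. exact: lin_purel (@lin_id _ _). Qed.

Lemma inLM l l' : inL B (l * l') = inL B l * inL B l'.
Proof.
rewrite -[RHS]/(bicross_mul _ _) bicross_mulE comul1 tsum_pure.
  by rewrite (act_1 (act_module_algebra B)) mulr1.
apply: balanced_lin => x.
- by apply: lin_purel; apply: lin_mulr; exact: lin_id.
- by apply: lin_purer; apply: lin_mull; apply: lin_actr; exact: lin_id.
Qed.

(** Since [K] acts on the unit of [L] through the counit, the coproduct in the twisted product
    collapses. *)
Lemma inKM k k' : inK B (k * k') = inK B k * inK B k'.
Proof.
rewrite -[RHS]/(bicross_mul _ _) bicross_mulE /inK -[in LHS](comul_counitr k').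
rewrite (raddf_tsum _ _ (mulrDr k)) (raddf_tsum _ _ (fun x y => pureDl x y 1)).
apply: eq_tsum => x y; rewrite (act_alg1 (act_module_algebra B)).
by rewrite mulr1 pureZr -scalerAr pureZl.
Qed.

Lemma bicross_ind (P : bicrossproduct B -> Prop) :
  P 0 -> (forall u v, P u -> P v -> P (u + v)) ->
  (forall k l, P (inK B k * inL B l)) -> forall u, P u.
Proof.
by move=> P0 PD Pp u; elim/tensor_ind: u => // k l; rewrite -(inK_inL B).
Qed.

End Embeddings.

(** * The star on the bicrossproduct *)

Section BicrossStar.
Variables (F : fieldType) (conjF : F -> F).
Hypothesis conj1 : conjF 1 = 1.
Variables (K L : hopfAlgType F) (B : bicross_data K L).
Variables (starK : K -> K) (starL : L -> L).
Hypothesis hK : hopf_star_structure conjF starK.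
Hypothesis hL : hopf_star_structure conjF starL.
Hypothesis compat : forall (k : K) (l : L),
  starL (act B l k) = act B (starL l) (starK (antipode k)).

Let aK := star_antilinear (hopf_star hK).
Let aL := star_antilinear (hopf_star hL).

(** The summand is antilinear in [k] and in [l], hence balanced, so the sum does not depend on how
    [u] is written. *)
Definition bicross_star (u : bicrossproduct B) : bicrossproduct B :=
  \sw_(k, l <- u) (inL B (starL l) * inK B (starK k)).

Lemma bicross_star_term_antilinearl l :
  antilinear conjF (fun k => inL B (starL l) * inK B (starK k)).
Proof. exact: antilinear_comp (lin_mulr _ (@inK_linear _ _ _ B)) aK. Qed.

Lemma bicross_star_term_antilinearr k :
  antilinear conjF (fun l => inL B (starL l) * inK B (starK k)).
Proof. exact: antilinear_comp (lin_mull _ (@inL_linear _ _ _ B)) aL. Qed.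

Lemma bicross_star_antilinear : antilinear conjF bicross_star.
Proof.
exact: (antilinear_tsum conj1) bicross_star_term_antilinearl
  bicross_star_term_antilinearr.
Qed.

Let starD := antilinearD conj1 bicross_star_antilinear.
Let star0 := antilinear0 conj1 bicross_star_antilinear.

Lemma bicross_starE k l :
  bicross_star (inK B k * inL B l) = inL B (starL l) * inK B (starK k).
Proof.
rewrite inK_inL /bicross_star tsum_pure //.
exact: (balanced_antilinear conj1) bicross_star_term_antilinearl
  bicross_star_term_antilinearr.
Qed.

Lemma bicross_star_LK l k :
  bicross_star (inL B l * inK B k) = inK B (starK k) * inL B (starL l).
Proof.
(* The map [g] is chosen so that [g k 1] is the right-hand side, while the left-hand side is [g]
   summed over k_1 ⊗ k_2 S(k_3), which equals k ⊗ 1. *)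
pose g x y : K ⊗ L := starK x ⊗ act B (starL l) (starK y).
have bg : balanced g.
  apply: (balanced_antilinear conj1) => x.
  - exact: antilinear_comp (lin_purel _ (@lin_id _ _)) aK.
  - exact: antilinear_comp (lin_purer _ (lin_actr _ _ (@lin_id _ _))) aK.
have bact m : balanced (fun x y => x ⊗ act B m y : K ⊗ L).
  apply: balanced_lin => x; first by apply: lin_purel; exact: lin_id.
  by apply: lin_purer; apply: lin_actr; exact: lin_id.
rewrite inL_inK (raddf_tsum _ _ starD) inK_inL.
transitivity (tsum g (k ⊗ 1)); last first.
  rewrite tsum_pure // /g (star1 (hopf_star hK)).
  by rewrite (act_1 (act_module_algebra B)).
rewrite -comul_antipoder tsum_tsum //; apply: eq_tsum => x y.
rewrite tsum_tsum // -inK_inL bicross_starE inL_inK compat (star_comul hK).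
rewrite tsum_tsum //; apply: eq_tsum => x1 x2; rewrite tsum_pure // tsum_pure //.
(* The star reverses k_2 S(k_3), and a right action applies the left factor first: S(k_3)^* acts
   before k_2^*, as on the other side. *)
by rewrite /g (starM (hopf_star hK)) (act_M (act_module_algebra B)).
Qed.

Lemma bicross_starM u v :
  bicross_star (u * v) = bicross_star v * bicross_star u.
Proof.
elim/bicross_ind: u => [|u1 u2 h1 h2|k l].
- by rewrite mul0r star0 mulr0.
- by rewrite mulrDl !starD mulrDr h1 h2.
elim/bicross_ind: v => [|v1 v2 h1 h2|k' l'].
- by rewrite mulr0 star0 mul0r.
- by rewrite mulrDr !starD mulrDl h1 h2.
(* For w = k_1 l_1 the product k w l' is (k k_1)(l_1 l'), again an element of K times one of L, so
   the stars of [K] and [L] suffice. It is used below with w = l k'. *)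
have sandwich w : bicross_star (inK B k * w * inL B l')
    = inL B (starL l') * bicross_star w * inK B (starK k).
  elim/bicross_ind: w => [|w1 w2 h1 h2|k1 l1].
  - by rewrite mulr0 mul0r star0 mulr0 mul0r.
  - by rewrite mulrDr mulrDl !starD mulrDr mulrDl h1 h2.
  rewrite !mulrA -inKM -mulrA -inLM !bicross_starE.
  by rewrite (starM (hopf_star hK)) (starM (hopf_star hL)) inKM inLM !mulrA.
have -> : inK B k * inL B l * (inK B k' * inL B l')
    = inK B k * (inL B l * inK B k') * inL B l' by rewrite !mulrA.
by rewrite sandwich bicross_star_LK !bicross_starE !mulrA.
Qed.

Lemma bicross_starK : involutive bicross_star.
Proof.
elim/bicross_ind => [|u v hu hv|k l]; first by rewrite !star0.
- by rewrite !starD hu hv.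
rewrite bicross_starE bicross_star_LK.
by rewrite (star_involutive (hopf_star hK)) (star_involutive (hopf_star hL)).
Qed.

(** The products k l generate the bicrossproduct additively, so they fix an antilinear map; this is
    the sense in which the formula determines the star. *)
Lemma bicross_star_unique (f : bicrossproduct B -> bicrossproduct B) :
  antilinear conjF f ->
  (forall k l, f (inK B k * inL B l) = inL B (starL l) * inK B (starK k)) ->
  f =1 bicross_star.
Proof.
move=> hf fE; elim/bicross_ind => [|u v hu hv|k l].
- by rewrite star0 (antilinear0 conj1 hf).
- by rewrite starD (antilinearD conj1 hf) hu hv.
- by rewrite fE bicross_starE.
Qed.

End BicrossStar.

Theorem theorem2p2 (R : realType) (F : fieldType) (conjF : F -> F)
    (hF : real_or_complex R conjF)
    (K L : hopfAlgType F) (B : bicross_data K L)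
    (starK : K -> K) (starL : L -> L)
    (hK : hopf_star_structure conjF starK)
    (hL : hopf_star_structure conjF starL)
    (compat : forall (k : K) (l : L),
       starL (act B l k) = act B (starL l) (starK (antipode k))) :
  exists starH : bicrossproduct B -> bicrossproduct B,
    [/\ star_structure conjF starH,
        forall (k : K) (l : L),
          starH (inK B k * inL B l) = inL B (starL l) * inK B (starK k)
      & forall f : bicrossproduct B -> bicrossproduct B,
          antilinear conjF f ->
          (forall (k : K) (l : L),
             f (inK B k * inL B l) = inL B (starL l) * inK B (starK k)) ->
          f =1 starH].
Proof.
have conj1 : conjF 1 = 1 by case: hF => //; exact: rmorph1.
exists (bicross_star starK starL); split.
- split; first exact: bicross_star_antilinear.
  + exact: (bicross_starK conj1 hK hL compat).
  + exact: (bicross_starM conj1 hK hL compat).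
- exact: (bicross_starE conj1 B hK hL).
- by move=> f; exact: (bicross_star_unique conj1 hK hL).
Qed.
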